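(* For any analytic map $b:\mathbb{D}\to\mathbb{D}$, the composition operator $C_b$ is bounded on $H^2$, and $$\|C_b\|\le\left(\frac{1+|b(0)|}{1-|b(0)|}\right)^{1/2}.$$
   Context: $\mathbb{D}$ is the open unit disk in $\mathbb{C}$. $H^2=H^2(\mathbb{D})$ is the Hardy space of analytic functions on $\mathbb{D}$ with norm $\|f\|^2=\sup_{0<r<1}\frac1{2\pi}\int_0^{2\pi}|f(re^{i\theta})|^2\,d\theta<\infty$. The composition operator with symbol $b$ is $(C_bf)(z)=f(b(z))$. *)

(* Defs.v *)
From Stdlib Require Import Reals.
From Coquelicot Require Import Coquelicot.

Local Open Scope R_scope.

Definition disk (z : C) : Prop := Cmod z < 1.

(** Functions on the disk are represented by total functions [C -> C]; their
    values outside the disk are irrelevant. As the disk is open, [ex_derive]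
    (here complex differentiability, over the field [C]) at a point of the disk
    depends only on the values of [f] in the disk. *)
Definition analytic_on_disk (f : C -> C) : Prop :=
  forall z : C, disk z -> ex_derive (K := C_AbsRing) (V := C_NormedModule) f z.

(** Equality of [f] and [g] as functions on the disk. *)
Definition eq_on_disk (f g : C -> C) : Prop :=
  forall z : C, disk z -> f z = g z.

Definition circle_point (r theta : R) : C := (r * cos theta, r * sin theta).

Definition circle_mean_sq (f : C -> C) (r : R) : R :=
  / (2 * PI) * RInt (fun theta => Cmod (f (circle_point r theta)) ^ 2) 0 (2 * PI).

Definition H2_norm_sq (f : C -> C) : Rbar :=
  Lub_Rbar (fun x => exists r : R, 0 < r < 1 /\ x = circle_mean_sq f r).

Definition H2 (f : C -> C) : Prop :=
  analytic_on_disk f /\ is_finite (H2_norm_sq f).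

(** Meaningful only for [f] in [H2], since [real] sends infinities to 0. *)
Definition H2_norm (f : C -> C) : R := sqrt (real (H2_norm_sq f)).

(** The first two clauses say that [T] induces a map from H^2 to itself, where
    elements of H^2 are functions on the disk. *)
Record H2_bounded_operator (T : (C -> C) -> (C -> C)) : Prop := {
  H2_op_maps : forall f, H2 f -> H2 (T f);
  H2_op_ext : forall f g, H2 f -> H2 g -> eq_on_disk f g -> eq_on_disk (T f) (T g);
  H2_op_add : forall f g, H2 f -> H2 g ->
    eq_on_disk (T (fun z => Cplus (f z) (g z))) (fun z => Cplus (T f z) (T g z));
  H2_op_scal : forall (c : C) f, H2 f ->
    eq_on_disk (T (fun z => Cmult c (f z))) (fun z => Cmult c (T f z));
  H2_op_bound : exists M : R, forall f, H2 f -> H2_norm (T f) <= M * H2_norm f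
}.

Definition H2_opnorm (T : (C -> C) -> (C -> C)) : Rbar :=
  Lub_Rbar (fun x => exists f : C -> C, H2 f /\ H2_norm f <= 1 /\ x = H2_norm (T f)).

Definition composition_operator (b : C -> C) (f : C -> C) : C -> C :=
  fun z => f (b z).

(* Main.v *)
Require Import Defs.
From Stdlib Require Import Reals Lra ClassicalEpsilon.
From Coquelicot Require Import Coquelicot.

(** The theorem is Littlewood's subordination principle with its sharp constant.
    Write P_s(w, z) = (s^2 - |w|^2) / |z - w|^2 for the Poisson kernel of the disk
    of radius s, with |z| = s > |w|.

    If f is analytic on the closed disk of radius s, then |f(w)|^2 is at most
    the mean of P_s(w, z) |f(z)|^2 over the circle |z| = s
    ([Cmod_sq_le_poisson_mean]). Now put w = b(zeta) and average over the circle
    |zeta| = r, where s is chosen so large that b maps the disk of radius r into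
    the disk of radius s. As a function of zeta, P_s(b(zeta), z) is the real part
    of the analytic function (z + b) / (z - b), so its mean is P_s(b(0), z)
    ([circle_mean_poisson_comp]), which is at most (s + |b(0)|) / (s - |b(0)|).
    Exchanging the two averages gives
      M_r(f o b) <= (s + |b(0)|) / (s - |b(0)|) M_s(f)
    for the mean squares M over circles ([circle_mean_sq_comp_le]); then let s tend to 1.

    The only complex analysis behind this is the mean value property for
    functions that are merely complex differentiable. It rests on Goursat's
    argument, run in polar coordinates: the imaginary part of the form g(z) dz / z
    has zero circulation along the boundary of polar rectangles
    ([circulation_polar_zero]), and on a full annulus the two radial sides
    cancel, so that the circle means of g do not depend on the radius
    ([circle_mean_radius_indep]). By continuity the mean equals g(0), and
    continuity also carries the means across a circle on which g is not known to
    be differentiable ([circle_mean_value_except]). That freedom is what lets the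
    difference quotient (f(z) - f(w)) / (z - w) be averaged, which yields Poisson's
    formula without power series or removable singularities. *)

Local Open Scope R_scope.

(** * Complex differentiability and continuity *)

(** The derivative of the Hardy space definitions takes its values in the normed
    module [C], whose uniform structure is that of the product of two lines. The
    rules for products and compositions require the structure given by the
    modulus, so everything below is done with the latter. *)
Local Notation Cdiff := (ex_derive (K := C_AbsRing) (V := AbsRing_NormedModule C_AbsRing)).
Local Notation Ccont := (continuous (T := AbsRing_UniformSpace C_AbsRing) (U := AbsRing_UniformSpace C_AbsRing)).

(** Differentiability compares norms only, and both normed modules have the
    modulus as their norm. *)
Lemma ex_derive_Cdiff (f : C -> C) (z : C) :
  ex_derive (K := C_AbsRing) (V := C_NormedModule) f z <-> Cdiff f z.
Proof.
split; intros [l [_ H]]; exists l; (split; [ apply is_linear_scal_l | exact H]).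
Qed.

Lemma is_derive_C_eps (f : C -> C) (z l : C) :
  is_derive (K := C_AbsRing) (V := AbsRing_NormedModule C_AbsRing) f z l <->
  forall eps : posreal, exists delta : posreal, forall w, Cmod (w - z)%C < delta ->
    Cmod (f w - f z - (w - z) * l)%C <= eps * Cmod (w - z)%C.
Proof.
split.
- intros [_ H] eps.
  destruct (H z (fun P HP => HP) eps) as [d Hd].
  exists d; intros w Hw; exact (Hd w Hw).
- intros H; split; [ apply is_linear_scal_l | ].
  intros x Hx.
  assert (E : z = x) by exact (is_filter_lim_locally_unique (K := C_AbsRing) (V := AbsRing_NormedModule C_AbsRing) z x Hx).
  rewrite <- E; intros eps. destruct (H eps) as [d Hd].
  exists d; intros w Hw; exact (Hd w Hw).
Qed.

Lemma Ccont_eps (f : C -> C) (z : C) :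
  Ccont f z <->
  forall eps : posreal, exists delta : posreal, forall w, Cmod (w - z)%C < delta ->
    Cmod (f w - f z)%C < eps.
Proof.
split.
- intros H eps.
  destruct (H _ (locally_ball (T := AbsRing_UniformSpace C_AbsRing) (f z) eps)) as [d Hd].
  exists d; intros w Hw; exact (Hd w Hw).
- intros H P [eps HP]. destruct (H eps) as [d Hd].
  exists d; intros w Hw; apply HP; exact (Hd w Hw).
Qed.

Lemma Cdiff_Ccont (f : C -> C) (z : C) : Cdiff f z -> Ccont f z.
Proof. apply (ex_derive_continuous (K := C_AbsRing) (V := AbsRing_NormedModule C_AbsRing)). Qed.

Lemma Cdiff_mult (f g : C -> C) (z : C) : Cdiff f z -> Cdiff g z -> Cdiff (fun x => f x * g x)%C z.
Proof.
intros [l Hl] [m Hm]; eexists; apply (is_derive_mult (K := C_AbsRing) f g z l m Hl Hm).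
intros; apply Cmult_comm.
Qed.

Lemma Cdiff_plus (f g : C -> C) (z : C) : Cdiff f z -> Cdiff g z -> Cdiff (fun x => f x + g x)%C z.
Proof. apply (ex_derive_plus (K := C_AbsRing) (V := AbsRing_NormedModule C_AbsRing)). Qed.

Lemma Cdiff_const (c z : C) : Cdiff (fun _ => c) z.
Proof. apply (ex_derive_const (K := C_AbsRing) (V := AbsRing_NormedModule C_AbsRing)). Qed.

Lemma Cdiff_id (z : C) : Cdiff (fun x => x) z.
Proof. apply (ex_derive_id (K := C_AbsRing)). Qed.

Lemma Cdiff_minus (f g : C -> C) (z : C) : Cdiff f z -> Cdiff g z -> Cdiff (fun x => f x - g x)%C z.
Proof. apply (ex_derive_minus (K := C_AbsRing) (V := AbsRing_NormedModule C_AbsRing)). Qed.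

Lemma Cdiff_comp (f g : C -> C) (z : C) : Cdiff f (g z) -> Cdiff g z -> Cdiff (fun x => f (g x)) z.
Proof. apply (ex_derive_comp (K := C_AbsRing) (V := AbsRing_NormedModule C_AbsRing)). Qed.

Lemma Cdiff_inv (z : C) : z <> 0%C -> Cdiff (fun x => / x)%C z.
Proof.
intros Hz.
assert (Hm : 0 < Cmod z) by now apply Cmod_gt_0.
exists (- / (z * z))%C. apply is_derive_C_eps; intros eps.
set (m := Cmod z) in *.
assert (Hd : 0 < Rmin (m / 2) (eps * (m * m * m) / 2)).
{ apply Rmin_case; [ lra | ].
  assert (0 < eps * (m * m * m)); [ | lra].
  repeat apply Rmult_lt_0_compat; try assumption; apply cond_pos. }
exists (mkposreal _ Hd); simpl; intros w Hw.
assert (H1 : Cmod (w - z)%C < m / 2) by (eapply Rlt_le_trans; [ exact Hw | apply Rmin_l]).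
assert (H2 : Cmod (w - z)%C < eps * (m * m * m) / 2) by (eapply Rlt_le_trans; [ exact Hw | apply Rmin_r]).
assert (H3 : m / 2 < Cmod w).
{ assert (m <= Cmod w + Cmod (w - z)%C); [ | lra].
  unfold m; replace z with (w + - (w - z))%C at 1 by ring.
  eapply Rle_trans; [ apply Cmod_triangle | ]. rewrite Cmod_opp; lra. }
assert (Hw0 : w <> 0%C) by (apply Cmod_gt_0; lra).
replace (/ w - / z - (w - z) * - / (z * z))%C
  with ((w - z) * ((w - z) / (w * (z * z))))%C by (field; split; assumption).
rewrite Cmod_mult, Cmod_div, !Cmod_mult by (repeat apply Cmult_neq_0; assumption).
fold m. rewrite (Rmult_comm eps). apply Rmult_le_compat_l; [ apply Cmod_ge_0 | ].
apply Rle_div_l; [ repeat apply Rmult_lt_0_compat; lra | ].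
apply Rle_trans with (eps * (m * m * m) / 2); [ lra | ].
replace (eps * (m * m * m) / 2) with (eps * (m / 2 * (m * m))) by field.
apply Rmult_le_compat_l; [ apply Rlt_le, cond_pos | ].
apply Rmult_le_compat_r; [ | lra]. apply Rmult_le_pos; lra.
Qed.

Lemma Cdiff_div (f g : C -> C) (z : C) : Cdiff f z -> Cdiff g z -> g z <> RtoC 0 -> Cdiff (fun x => f x / g x)%C z.
Proof.
intros Hf Hg H0; apply Cdiff_mult; [ exact Hf | ].
apply (Cdiff_comp Cinv g); [ now apply Cdiff_inv | exact Hg].
Qed.

Lemma Cdiff_ext_loc (f g : C -> C) (z : C) :
  locally (T := AbsRing_UniformSpace C_AbsRing) z (fun x => f x = g x) -> Cdiff f z -> Cdiff g z.
Proof. apply (ex_derive_ext_loc (K := C_AbsRing) (V := AbsRing_NormedModule C_AbsRing)). Qed.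

Lemma Ccont_mult (f g : C -> C) (z : C) : Ccont f z -> Ccont g z -> Ccont (fun x => f x * g x)%C z.
Proof. apply (continuous_mult (K := C_AbsRing)). Qed.

Lemma Cmod_circle_point r t : Cmod (circle_point r t) = Rabs r.
Proof.
unfold Cmod, circle_point; simpl.
replace (r * cos t * (r * cos t * 1) + r * sin t * (r * sin t * 1)) with (r * r * (Rsqr (sin t) + Rsqr (cos t))).
- rewrite sin2_cos2, Rmult_1_r. apply sqrt_Rsqr_abs.
- unfold Rsqr; ring.
Qed.

Lemma Rabs_sin_le x : Rabs (sin x) <= Rabs x.
Proof.
assert (P : forall y, 0 <= y -> Rabs (sin y) <= y).
{ intros y [Hy | <-]; [ | rewrite sin_0, Rabs_R0; lra ].
  apply Rabs_le; split.
  - destruct (Rle_dec y PI) as [H | H].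
    + assert (0 <= sin y) by (apply sin_ge_0; lra); lra.
    + generalize (SIN_bound y) PI2_1; intros; lra.
  - apply Rlt_le, sin_lt_x, Hy. }
destruct (Rle_dec 0 x) as [H | H].
- rewrite (Rabs_pos_eq x) by assumption; now apply P.
- rewrite (Rabs_left x), <- Rabs_Ropp, <- sin_neg by lra. apply P; lra.
Qed.

(** The difference splits into a radial part and a chord of the circle of radius
    [r]; a chord is no longer than its arc. *)
Lemma Cmod_circle_point_minus u v r t :
  Cmod (circle_point u v - circle_point r t)%C <= Rabs (u - r) + Rabs r * Rabs (v - t).
Proof.
replace (circle_point u v - circle_point r t)%C
  with (circle_point (u - r) v + RtoC r * (circle_point 1 v - circle_point 1 t))%C
  by (apply injective_projections; simpl; ring).
eapply Rle_trans; [ apply Cmod_triangle | ].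
rewrite Cmod_mult, Cmod_circle_point, Cmod_R.
apply Rplus_le_compat_l, Rmult_le_compat_l; [ apply Rabs_pos | ].
rewrite <- (sqrt_Rsqr_abs (v - t)). unfold Cmod. apply sqrt_le_1_alt.
replace (_ ^ 2 + _ ^ 2) with (Rsqr (2 * sin ((v - t) / 2))).
- replace (v - t) with (2 * ((v - t) / 2)) at 2 by field.
  rewrite !Rsqr_mult. apply Rmult_le_compat_l; [ apply Rle_0_sqr | ].
  apply Rsqr_le_abs_1, Rabs_sin_le.
- unfold circle_point; simpl.
  assert (E : cos (v - t) = 1 - 2 * Rsqr (sin ((v - t) / 2))).
  { replace (v - t) with (2 * ((v - t) / 2)) at 1 by field. rewrite cos_2a_sin. unfold Rsqr; ring. }
  rewrite cos_minus in E.
  generalize (sin2_cos2 v) (sin2_cos2 t); unfold Rsqr in *; intros. nra.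
Qed.

Lemma Ccont_circle_point (g : C -> C) r t :
  Ccont g (circle_point r t) ->
  forall eps : posreal, locally_2d (fun u v =>
    Cmod (g (circle_point u v) - g (circle_point r t))%C < eps) r t.
Proof.
intros H eps. destruct (proj1 (Ccont_eps _ _) H eps) as [d Hd].
assert (Hp : 0 < d / (1 + Rabs r)).
{ apply Rdiv_lt_0_compat; [ apply cond_pos | generalize (Rabs_pos r); lra]. }
exists (mkposreal _ Hp); simpl; intros u v Hu Hv. apply Hd.
eapply Rle_lt_trans; [ apply Cmod_circle_point_minus | ].
apply Rlt_le_trans with (d / (1 + Rabs r) + Rabs r * (d / (1 + Rabs r))).
- apply Rplus_lt_le_compat; [ assumption | ].
  apply Rmult_le_compat_l; [ apply Rabs_pos | lra].
- right; field. generalize (Rabs_pos r); lra.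
Qed.

Lemma im_le_Cmod c : Rabs (Im c) <= Cmod c.
Proof. eapply Rle_trans; [ | apply Rmax_Cmod]; apply Rmax_r. Qed.

Lemma continuity_2d_Re_circle_point (g : C -> C) r t :
  Ccont g (circle_point r t) -> continuity_2d_pt (fun x y => Re (g (circle_point x y))) r t.
Proof.
intros H eps. destruct (Ccont_circle_point g r t H eps) as [d Hd].
exists d; intros u v Hu Hv. specialize (Hd u v Hu Hv).
eapply Rle_lt_trans; [ | exact Hd].
apply (re_le_Cmod (g (circle_point u v) - g (circle_point r t))%C).
Qed.

Lemma continuity_2d_Im_circle_point (g : C -> C) r t :
  Ccont g (circle_point r t) -> continuity_2d_pt (fun x y => Im (g (circle_point x y))) r t.
Proof.
intros H eps. destruct (Ccont_circle_point g r t H eps) as [d Hd].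
exists d; intros u v Hu Hv. specialize (Hd u v Hu Hv).
eapply Rle_lt_trans; [ | exact Hd].
apply (im_le_Cmod (g (circle_point u v) - g (circle_point r t))%C).
Qed.

(** * Subdivision of rectangles and circulation *)

Lemma nested_intervals (a l : nat -> R) :
  (forall n, 0 <= l n) -> (forall n, a n <= a (S n)) ->
  (forall n, a (S n) + l (S n) <= a n + l n) ->
  exists x, forall n, a n <= x <= a n + l n.
Proof.
intros Hl Ha Hb.
assert (Ha' : forall n k, a n <= a (n + k)%nat).
{ intros n k; induction k as [|k IH]; [ rewrite Nat.add_0_r; lra | ].
  rewrite Nat.add_succ_r; eapply Rle_trans; [ exact IH | apply Ha]. }
assert (Hb' : forall n k, a (n + k)%nat + l (n + k)%nat <= a n + l n).
{ intros n k; induction k as [|k IH]; [ rewrite Nat.add_0_r; lra | ].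
  rewrite Nat.add_succ_r; eapply Rle_trans; [ apply Hb | exact IH]. }
assert (Hab : forall n m, a n <= a m + l m).
{ intros n m. apply Rle_trans with (a (n + m)%nat); [ apply Ha' | ].
  rewrite Nat.add_comm. apply Rle_trans with (a (m + n)%nat + l (m + n)%nat); [ | apply Hb'].
  generalize (Hl (m + n)%nat); lra. }
destruct (completeness (fun x => exists n, x = a n)) as [x [Hx1 Hx2]].
- exists (a O + l O); intros x [n ->]; apply Hab.
- exists (a O); now exists O.
- exists x; intros n; split.
  + apply Hx1; now exists n.
  + apply Hx2; intros y [m ->]; apply Hab.
Qed.

(** Bisection, as an induction principle: a property of the rectangles similar to a
    given one holds for it, provided that it passes from four quarters to the
    whole and that it holds for all small rectangles around each point. Keeping the
    shape fixed is essential to Goursat's argument, where the error on a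
    rectangle has to be compared with its area. *)
Lemma rectangle_induction (A B x0 y0 : R) (P : R -> R -> R -> Prop) :
  0 <= A -> 0 <= B ->
  let inside a b h := x0 <= a /\ a + h * A <= x0 + A /\ y0 <= b /\ b + h * B <= y0 + B in
  (forall a b h, 0 < h -> inside a b (2 * h) ->
    P a b h -> P (a + h * A) b h -> P a (b + h * B) h -> P (a + h * A) (b + h * B) h ->
    P a b (2 * h)) ->
  (forall x y, x0 <= x <= x0 + A -> y0 <= y <= y0 + B ->
    exists delta : posreal, forall a b h, 0 < h < delta -> inside a b h ->
      a <= x <= a + h * A -> b <= y <= b + h * B -> P a b h) ->
  P x0 y0 1.
Proof.
intros HA HB inside Hc Hloc.
apply NNPP; intros H0.
set (h := fun n => (/ 2) ^ n).
assert (Hh : forall n, 0 < h n) by (intros n; apply pow_lt; lra).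
assert (HhS : forall n, h n = 2 * h (S n)) by (intros n; unfold h; simpl; field).
(* If the property fails for the whole, it fails for one quarter at each step. *)
set (bad := fun n (p : R * R) => inside (fst p) (snd p) (h n) /\ ~ P (fst p) (snd p) (h n)).
assert (step : forall n p, exists q, bad n p ->
  bad (S n) q /\ (fst q = fst p \/ fst q = fst p + h (S n) * A)
    /\ (snd q = snd p \/ snd q = snd p + h (S n) * B)).
{ intros n [a b]. destruct (classic (bad n (a, b))) as [[Hi Hb] | Hn]; [ | exists (a, b); tauto].
  unfold bad; simpl in *. rewrite (HhS n) in *. specialize (Hh (S n)); set (k := h (S n)) in *.
  assert (Hi' : forall u v, (u = a \/ u = a + k * A) -> (v = b \/ v = b + k * B) -> inside u v k).
  { assert (0 <= k * A) by (apply Rmult_le_pos; lra).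
    assert (0 <= k * B) by (apply Rmult_le_pos; lra).
    intros u v [-> | ->] [-> | ->]; unfold inside in *; lra. }
  apply NNPP; intros Hne. apply Hb, Hc; try assumption; apply NNPP; intros Hp; apply Hne;
    eexists (_, _); intros _; simpl; (split; [ split; [ | exact Hp ] | split ]);
    try apply Hi'; tauto. }
set (next := fun n p => proj1_sig (constructive_indefinite_description _ (step n p))).
set (s := fix s n := match n with O => (x0, y0) | S n => next n (s n) end).
assert (Hs : forall n, bad n (s n)).
{ induction n as [|n IH].
  - unfold bad, h; simpl; split; [ unfold inside; lra | exact H0].
  - simpl. unfold next.
    destruct (constructive_indefinite_description _ (step n (s n))) as [q Hq]; simpl; tauto. }
assert (HsS : forall n, (fst (s (S n)) = fst (s n) \/ fst (s (S n)) = fst (s n) + h (S n) * A)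
    /\ (snd (s (S n)) = snd (s n) \/ snd (s (S n)) = snd (s n) + h (S n) * B)).
{ intros n. simpl. unfold next.
  destruct (constructive_indefinite_description _ (step n (s n))) as [q Hq]; simpl.
  apply Hq, Hs. }
assert (Hpos : forall n D, 0 <= D -> 0 <= h n * D).
{ intros n D HD; apply Rmult_le_pos; [ apply Rlt_le, Hh | exact HD]. }
destruct (nested_intervals (fun n => fst (s n)) (fun n => h n * A)) as [x Hx].
{ intros n; now apply Hpos. }
{ intros n; generalize (Hpos (S n) A HA); destruct (HsS n) as [[-> | ->] _]; lra. }
{ intros n; rewrite (HhS n). generalize (Hpos (S n) A HA); destruct (HsS n) as [[-> | ->] _]; lra. }
destruct (nested_intervals (fun n => snd (s n)) (fun n => h n * B)) as [y Hy].
{ intros n; now apply Hpos. }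
{ intros n; generalize (Hpos (S n) B HB); destruct (HsS n) as [_ [-> | ->]]; lra. }
{ intros n; rewrite (HhS n). generalize (Hpos (S n) B HB); destruct (HsS n) as [_ [-> | ->]]; lra. }
destruct (Hloc x y) as [d Hd].
{ generalize (Hx O); unfold h; simpl; lra. }
{ generalize (Hy O); unfold h; simpl; lra. }
destruct (pow_lt_1_zero (/ 2)) with (y := pos d) as [n Hn].
{ rewrite Rabs_pos_eq; lra. }
{ apply cond_pos. }
destruct (Hs n) as [Hi HP]; apply HP, Hd; try assumption; [ | apply Hx | apply Hy].
split; [ apply Hh | ]. eapply Rle_lt_trans; [ apply Rle_abs | apply (Hn n); auto with arith].
Qed.

(** The boundary integral of the form W dx + U dy. *)
Definition circulation (U W : R -> R -> R) (a a' b b' : R) : R :=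
  (RInt (U a') b b' - RInt (U a) b b')
  - (RInt (fun x => W x b') a a' - RInt (fun x => W x b) a a').

(** The circulation is additive under subdivision, as is the area; so a
    circulation that is locally o(area) vanishes. *)
Lemma circulation_zero (U W : R -> R -> R) (x0 x1 y0 y1 : R) :
  x0 <= x1 -> y0 <= y1 ->
  (forall x y, x0 <= x <= x1 -> y0 <= y <= y1 -> continuous (U x) y) ->
  (forall x y, x0 <= x <= x1 -> y0 <= y <= y1 -> continuous (fun t => W t y) x) ->
  (forall x y, x0 <= x <= x1 -> y0 <= y <= y1 -> forall eps : posreal,
    exists delta : posreal, forall a b h, 0 < h < delta ->
      x0 <= a -> a + h * (x1 - x0) <= x1 -> y0 <= b -> b + h * (y1 - y0) <= y1 ->
      a <= x <= a + h * (x1 - x0) -> b <= y <= b + h * (y1 - y0) ->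
      Rabs (circulation U W a (a + h * (x1 - x0)) b (b + h * (y1 - y0))) <= eps * h ^ 2) ->
  circulation U W x0 x1 y0 y1 = 0.
Proof.
intros Hx Hy HU HW Hloc.
set (A := x1 - x0) in *; set (B := y1 - y0) in *.
assert (EU : forall x b b', x0 <= x <= x1 -> y0 <= b -> b <= b' -> b' <= y1 -> ex_RInt (U x) b b').
{ intros x b b' ? ? ? ?; apply (ex_RInt_continuous (V := R_CompleteNormedModule)).
  intros z; rewrite Rmin_left, Rmax_right by assumption; intros; apply HU; lra. }
assert (EW : forall y a a', y0 <= y <= y1 -> x0 <= a -> a <= a' -> a' <= x1 -> ex_RInt (fun x => W x y) a a').
{ intros x b b' ? ? ? ?; apply (ex_RInt_continuous (V := R_CompleteNormedModule)).
  intros z; rewrite Rmin_left, Rmax_right by assumption; intros; apply HW; lra. }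
apply Rabs_eq_0, Rle_antisym; [ | apply Rabs_pos].
apply le_epsilon; intros eps Heps. rewrite Rplus_0_l.
replace x1 with (x0 + 1 * A) by (unfold A; ring).
replace y1 with (y0 + 1 * B) by (unfold B; ring).
replace eps with (eps * 1 ^ 2) by ring.
apply (rectangle_induction A B x0 y0 (fun a b h =>
  Rabs (circulation U W a (a + h * A) b (b + h * B)) <= eps * h ^ 2)).
- unfold A; lra.
- unfold B; lra.
- intros a b h Hh [Ha1 [Ha2 [Hb1 Hb2]]] H1 H2 H3 H4.
  assert (HA : 0 <= h * A) by (apply Rmult_le_pos; unfold A; lra).
  assert (HB : 0 <= h * B) by (apply Rmult_le_pos; unfold B; lra).
  rewrite (Rplus_assoc a), (Rplus_assoc b) in *.
  replace (h * A + h * A) with (2 * h * A) in * by ring.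
  replace (h * B + h * B) with (2 * h * B) in * by ring.
  replace (x0 + A) with x1 in Ha2 by (unfold A; ring).
  replace (y0 + B) with y1 in Hb2 by (unfold B; ring).
  assert (E : circulation U W a (a + 2 * h * A) b (b + 2 * h * B) =
    circulation U W a (a + h * A) b (b + h * B) +
    circulation U W (a + h * A) (a + 2 * h * A) b (b + h * B) +
    (circulation U W a (a + h * A) (b + h * B) (b + 2 * h * B) +
    circulation U W (a + h * A) (a + 2 * h * A) (b + h * B) (b + 2 * h * B))).
  { unfold circulation.
    rewrite <- (RInt_Chasles (U (a + 2 * h * A)) b (b + h * B) (b + 2 * h * B)) by (apply EU; lra).
    rewrite <- (RInt_Chasles (U a) b (b + h * B) (b + 2 * h * B)) by (apply EU; lra).
    rewrite <- (RInt_Chasles (fun x => W x (b + 2 * h * B)) a (a + h * A) (a + 2 * h * A)) by (apply EW; lra).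
    rewrite <- (RInt_Chasles (fun x => W x b) a (a + h * A) (a + 2 * h * A)) by (apply EW; lra).
    unfold plus; simpl; ring. }
  rewrite E.
  replace (eps * (2 * h) ^ 2) with (eps * h ^ 2 + eps * h ^ 2 + (eps * h ^ 2 + eps * h ^ 2)) by ring.
  do 3 (try (eapply Rle_trans; [ apply Rabs_triang | ]; apply Rplus_le_compat)); assumption.
- replace (x0 + A) with x1 by (unfold A; ring).
  replace (y0 + B) with y1 by (unfold B; ring).
  intros x y Hx' Hy'. destruct (Hloc x y Hx' Hy' (mkposreal _ Heps)) as [d Hd].
  exists d; intros a b h Hh [? [? [? ?]]] ? ?. now apply Hd.
Qed.

(** * Goursat's theorem on polar rectangles *)

Lemma continuity_2d_pt_continuous_2 f x y : continuity_2d_pt f x y -> continuous (f x) y.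
Proof.
intros H P [eps HP]. destruct (H eps) as [d Hd].
exists d; intros v Hv; apply HP, Hd; [ | exact Hv].
rewrite Rminus_diag, Rabs_R0; apply cond_pos.
Qed.

Lemma continuity_2d_pt_continuous_1 f x y : continuity_2d_pt f x y -> continuous (fun t => f t y) x.
Proof.
intros H P [eps HP]. destruct (H eps) as [d Hd].
exists d; intros v Hv; apply HP, Hd; [ exact Hv | ].
rewrite Rminus_diag, Rabs_R0; apply cond_pos.
Qed.

Lemma RInt_near_increment (f s ds : R -> R) (a b M : R) :
  a <= b -> ex_RInt f a b ->
  (forall t, is_derive s t (ds t)) -> (forall t, continuous ds t) ->
  (forall t, a <= t <= b -> Rabs (f t - ds t) <= M) ->
  Rabs (RInt f a b - (s b - s a)) <= (b - a) * M.
Proof.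
intros Hab Hf Hs Hc HM.
assert (Hi : is_RInt ds a b (s b - s a)).
{ apply (is_RInt_derive (V := R_CompleteNormedModule) s ds); intros; [ apply Hs | apply Hc]. }
rewrite <- (is_RInt_unique _ _ _ _ Hi).
change (RInt f a b - RInt ds a b) with (minus (RInt f a b) (RInt ds a b)).
assert (Hds : ex_RInt ds a b) by (eexists; exact Hi).
rewrite <- (RInt_minus f ds) by assumption.
apply abs_RInt_le_const; try assumption.
now apply (ex_RInt_minus (V := R_NormedModule) f ds).
Qed.

(** Goursat's theorem for the imaginary part of g(z) dz / z, written in the
    coordinates (radius, angle). An affine function c + l z has zero circulation.
    By differentiability, near a point the function [g] differs from an affine one by
    epsilon times the diameter, and integrating this along a boundary of length
    comparable with the diameter gives an error of epsilon times the area. *)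
Lemma circulation_polar_zero (g : C -> C) (x0 x1 y0 y1 : R) :
  0 < x0 <= x1 -> y0 <= y1 ->
  (forall x y, x0 <= x <= x1 -> y0 <= y <= y1 -> Cdiff g (circle_point x y)) ->
  circulation (fun x y => Re (g (circle_point x y)))
              (fun x y => Im (g (circle_point x y)) / x) x0 x1 y0 y1 = 0.
Proof.
intros [Hx0 Hx] Hy Hg.
assert (HU : forall x y, x0 <= x <= x1 -> y0 <= y <= y1 ->
  continuous (fun y => Re (g (circle_point x y))) y).
{ intros x y Hx' Hy'.
  apply (continuity_2d_pt_continuous_2 (fun x y => Re (g (circle_point x y)))).
  now apply continuity_2d_Re_circle_point, Cdiff_Ccont, Hg. }
assert (HW : forall x y, x0 <= x <= x1 -> y0 <= y <= y1 ->
  continuous (fun t => Im (g (circle_point t y)) / t) x).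
{ intros x y Hx' Hy'. apply (continuous_mult (K := R_AbsRing)).
  - apply (continuity_2d_pt_continuous_1 (fun x y => Im (g (circle_point x y)))).
    now apply continuity_2d_Im_circle_point, Cdiff_Ccont, Hg.
  - apply (ex_derive_continuous (K := R_AbsRing) (V := R_NormedModule)).
    auto_derive; lra. }
apply circulation_zero; try assumption.
intros x y Hx' Hy' eps.
destruct (Hg x y Hx' Hy') as [l Hl]. rewrite is_derive_C_eps in Hl.
set (z := circle_point x y) in *.
set (A := x1 - x0) in *. set (B := y1 - y0) in *.
assert (HA : 0 <= A) by (unfold A; lra). assert (HB : 0 <= B) by (unfold B; lra).
set (D := A + x1 * B).
assert (HD : 0 <= D) by (unfold D; generalize (Rmult_le_pos x1 B); lra).
(* [h * D] bounds the distance to the base point in a rectangle of scale [h], and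
   [K * h ^ 2] the circulation of an error term bounded by [h * D]. *)
set (K := 2 * D * (B + A / x0)).
assert (HAx : 0 <= A / x0) by (apply Rdiv_le_0_compat; lra).
assert (HK : 0 <= K) by (unfold K; apply Rmult_le_pos; lra).
assert (He : 0 < eps / (K + 1)) by (apply Rdiv_lt_0_compat; [ apply cond_pos | lra]).
destruct (Hl (mkposreal _ He)) as [d Hd]; simpl in Hd.
assert (Hd' : 0 < d / (D + 1)) by (apply Rdiv_lt_0_compat; [ apply cond_pos | lra]).
exists (mkposreal _ Hd'); simpl; intros a b h [Hh0 Hh] Ha1 Ha2 Hb1 Hb2 Hxa Hyb.
assert (HhA : 0 <= h * A) by (apply Rmult_le_pos; lra).
assert (HhB : 0 <= h * B) by (apply Rmult_le_pos; lra).
set (a' := a + h * A) in *. set (b' := b + h * B) in *.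
set (e := fun u v => (g (circle_point u v) - g z - (circle_point u v - z) * l)%C).
set (E := eps / (K + 1) * (h * D)).
assert (HE : forall u v, a <= u <= a' -> b <= v <= b' -> Cmod (e u v) <= E).
{ intros u v Hu Hv.
  assert (H1 : Cmod (circle_point u v - z)%C <= h * D).
  { eapply Rle_trans; [ apply Cmod_circle_point_minus | ].
    rewrite (Rabs_pos_eq x) by lra.
    replace (h * D) with (h * A + x1 * (h * B)) by (unfold D; ring).
    apply Rplus_le_compat; [ apply Rabs_le; unfold a' in *; lra | ].
    apply Rmult_le_compat; try lra; [ apply Rabs_pos | apply Rabs_le; unfold b' in *; lra]. }
  eapply Rle_trans; [ apply Hd | apply Rmult_le_compat_l; [ lra | exact H1]].
  eapply Rle_lt_trans; [ exact H1 | ].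
  apply Rlt_div_r in Hh; [ | lra]. nra. }
(* [u * dS v] and [u * S v] are the real and imaginary parts of [l * circle_point u v]. *)
set (S := fun t => Re l * sin t + Im l * cos t).
set (dS := fun t => Re l * cos t - Im l * sin t).
assert (HS : forall t, is_derive S t (dS t)).
{ intros t; unfold S, dS; auto_derive; [ easy | ring]. }
assert (HdS : forall t, continuous dS t).
{ intros t; apply (ex_derive_continuous (K := R_AbsRing) (V := R_NormedModule)).
  unfold dS; auto_derive; easy. }
assert (EU : forall u v, Re (g (circle_point u v)) = Re (e u v) + Re (g z - z * l)%C + u * dS v).
{ intros u v; unfold e, dS, circle_point, Cminus; simpl.
  rewrite ?re_plus; unfold Re, Im; simpl; ring. }
assert (EW : forall u v, Im (g (circle_point u v)) = Im (e u v) + Im (g z - z * l)%C + u * S v).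
{ intros u v; unfold e, S, circle_point, Cminus; simpl.
  unfold Re, Im; simpl; ring. }
assert (Hex : forall u, x0 <= u <= x1 -> ex_RInt (fun t => Re (g (circle_point u t))) b b').
{ intros u Hu; apply (ex_RInt_continuous (V := R_CompleteNormedModule)).
  unfold b' in *; intros t; rewrite Rmin_left, Rmax_right by lra. intros; apply HU; lra. }
assert (Hex' : forall v, y0 <= v <= y1 -> ex_RInt (fun t => Im (g (circle_point t v)) / t) a a').
{ intros v Hv; apply (ex_RInt_continuous (V := R_CompleteNormedModule)).
  unfold a' in *; intros t; rewrite Rmin_left, Rmax_right by lra. intros; apply HW; lra. }
assert (Hea : ex_RInt (fun t => Re (g (circle_point a' t))) b b') by (apply Hex; lra).
assert (Hea0 : ex_RInt (fun t => Re (g (circle_point a t))) b b') by (apply Hex; lra).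
assert (Heb : ex_RInt (fun t => Im (g (circle_point t b')) / t) a a') by (apply Hex'; lra).
assert (Heb0 : ex_RInt (fun t => Im (g (circle_point t b)) / t) a a') by (apply Hex'; lra).
unfold circulation.
change (RInt (fun t => Re (g (circle_point a' t))) b b' - RInt (fun t => Re (g (circle_point a t))) b b')
  with (minus (RInt (fun t => Re (g (circle_point a' t))) b b') (RInt (fun t => Re (g (circle_point a t))) b b')).
change (RInt (fun t => Im (g (circle_point t b')) / t) a a' - RInt (fun t => Im (g (circle_point t b)) / t) a a')
  with (minus (RInt (fun t => Im (g (circle_point t b')) / t) a a') (RInt (fun t => Im (g (circle_point t b)) / t) a a')).
rewrite <- !RInt_minus by assumption.
assert (Hab : a <= a') by (unfold a'; lra). assert (Hbb : b <= b') by (unfold b'; lra).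
assert (H1 := RInt_near_increment
  (fun t => minus (Re (g (circle_point a' t))) (Re (g (circle_point a t))))
  (fun t => (a' - a) * S t) (fun t => (a' - a) * dS t) b b' (2 * E) Hbb).
assert (H2 := RInt_near_increment
  (fun t => minus (Im (g (circle_point t b')) / t) (Im (g (circle_point t b)) / t))
  (fun t => t * (S b' - S b)) (fun t => S b' - S b) a a' (2 * E / x0) Hab).
refine (Rle_trans _ _ _ _ (_ : (b' - b) * (2 * E) + (a' - a) * (2 * E / x0) <= _)).
- match goal with |- Rabs (?I1 - ?I2) <= _ =>
    replace (I1 - I2) with ((I1 - ((a' - a) * S b' - (a' - a) * S b)) +
      - (I2 - (a' * (S b' - S b) - a * (S b' - S b)))) by ring end.
  eapply Rle_trans; [ apply Rabs_triang | rewrite Rabs_Ropp; apply Rplus_le_compat].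
  + apply H1.
    * now apply (ex_RInt_minus (V := R_NormedModule)).
    * intros t. apply is_derive_scal, HS.
    * intros t. apply (continuous_scal_r (K := R_AbsRing) (V := R_NormedModule)), HdS.
    * intros t Ht. unfold minus, plus, opp; simpl. rewrite !EU.
      replace (_ - _) with (Re (e a' t) + - Re (e a t)) by ring.
      eapply Rle_trans; [ apply Rabs_triang | rewrite Rabs_Ropp].
      replace (2 * E) with (E + E) by ring.
      apply Rplus_le_compat; (eapply Rle_trans; [ apply re_le_Cmod | apply HE; lra]).
  + apply H2.
    * now apply (ex_RInt_minus (V := R_NormedModule)).
    * intros t. auto_derive; [ easy | ring].
    * intros t. apply continuous_const.
    * intros t Ht. unfold minus, plus, opp; simpl. rewrite !EW.
      replace (_ - _) with ((Im (e t b') + - Im (e t b)) / t) by (field; lra).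
      unfold Rdiv; rewrite Rabs_mult, Rabs_inv, (Rabs_pos_eq t) by lra.
      apply Rmult_le_compat; [ apply Rabs_pos | apply Rlt_le, Rinv_0_lt_compat; lra | | apply Rinv_le_contravar; lra].
      eapply Rle_trans; [ apply Rabs_triang | rewrite Rabs_Ropp].
      replace (2 * E) with (E + E) by ring.
      apply Rplus_le_compat; (eapply Rle_trans; [ apply im_le_Cmod | apply HE; lra]).
- replace ((b' - b) * (2 * E) + (a' - a) * (2 * E / x0)) with (eps * h ^ 2 * (K / (K + 1))).
  + apply Rle_trans with (eps * h ^ 2 * 1); [ apply Rmult_le_compat_l | lra].
    * apply Rmult_le_pos; [ apply Rlt_le, cond_pos | apply pow2_ge_0].
    * apply Rle_div_l; lra.
  + unfold K at 1, E, a', b'. field. split; lra.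
Qed.

(** * The mean value property *)

Definition circle_mean (h : C -> R) (r : R) : R :=
  / (2 * PI) * RInt (fun t => h (circle_point r t)) 0 (2 * PI).

Lemma two_PI_pos : 0 < 2 * PI.
Proof. generalize PI_RGT_0; lra. Qed.

Lemma ex_RInt_circle (g : C -> C) x :
  (forall z, Cmod z = Rabs x -> Ccont g z) ->
  ex_RInt (fun t => Re (g (circle_point x t))) 0 (2 * PI).
Proof.
intros H. apply (ex_RInt_continuous (V := R_CompleteNormedModule)). intros t _.
apply (continuity_2d_pt_continuous_2 (fun x y => Re (g (circle_point x y)))).
apply continuity_2d_Re_circle_point, H, Cmod_circle_point.
Qed.

(** The circulation along [x <= |z| <= y], cut along the positive axis,
    vanishes; both radial sides are the same segment, so what remains is the
    difference of the two circle means. *)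
Lemma circle_mean_radius_indep (g : C -> C) x y :
  0 < x <= y -> (forall z, x <= Cmod z <= y -> Cdiff g z) ->
  circle_mean (fun z => Re (g z)) x = circle_mean (fun z => Re (g z)) y.
Proof.
intros Hxy Hg. unfold circle_mean; f_equal.
generalize (circulation_polar_zero g x y 0 (2 * PI) Hxy).
unfold circulation.
replace (RInt (fun x => Im (g (circle_point x (2 * PI))) / x) x y)
  with (RInt (fun x => Im (g (circle_point x 0)) / x) x y).
- intros H; symmetry; apply Rminus_diag_uniq.
  eapply eq_trans; [ | apply H; [ apply Rlt_le, two_PI_pos | ]]; [ ring | ].
  intros u v Hu _; apply Hg. rewrite Cmod_circle_point, Rabs_pos_eq; lra.
- apply (RInt_ext (V := R_CompleteNormedModule)); intros t _.
  unfold circle_point. now rewrite cos_0, sin_0, cos_2PI, sin_2PI.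
Qed.

(** Uniform continuity is needed on the closed interval only, so [g] has to be
    controlled only on the closed disk. *)
Lemma circle_mean_unif_continuous (g : C -> C) r :
  (forall z, Cmod z <= r -> Ccont g z) ->
  forall eps, 0 < eps -> exists delta : posreal, forall x y, 0 <= x <= r -> 0 <= y <= r ->
    Rabs (y - x) < delta ->
    Rabs (circle_mean (fun z => Re (g z)) y - circle_mean (fun z => Re (g z)) x) <= eps.
Proof.
intros Hg eps Heps.
assert (Hr : forall x t, 0 <= x <= r -> Cmod (circle_point x t) <= r).
{ intros x t Hx; rewrite Cmod_circle_point, Rabs_pos_eq; lra. }
destruct (uniform_continuity_2d (fun x y => Re (g (circle_point x y))) 0 r 0 (2 * PI))
  with (eps := mkposreal _ Heps) as [d Hd].
{ intros x y Hx _. now apply continuity_2d_Re_circle_point, Hg, Hr. }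
exists d; intros x y Hx Hy Hxy. generalize two_PI_pos; intros HPI.
unfold circle_mean; rewrite <- Rmult_minus_distr_l.
assert (E : forall x, 0 <= x <= r -> ex_RInt (fun t => Re (g (circle_point x t))) 0 (2 * PI)).
{ intros u Hu; apply ex_RInt_circle; intros z Hz; apply Hg. rewrite Hz, Rabs_pos_eq; lra. }
change (RInt (fun t => Re (g (circle_point y t))) 0 (2 * PI) - RInt (fun t => Re (g (circle_point x t))) 0 (2 * PI))
  with (minus (RInt (fun t => Re (g (circle_point y t))) 0 (2 * PI)) (RInt (fun t => Re (g (circle_point x t))) 0 (2 * PI))).
rewrite <- RInt_minus by now apply E.
rewrite Rabs_mult, Rabs_inv, (Rabs_pos_eq (2 * PI)) by lra.
rewrite Rmult_comm. apply Rle_div_l; [ lra | ].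
replace (eps * (2 * PI)) with ((2 * PI - 0) * eps) by ring.
apply abs_RInt_le_const; [ lra | | ].
- apply (ex_RInt_minus (V := R_NormedModule)); now apply E.
- intros t Ht. apply Rlt_le, Hd; try assumption.
  rewrite Rminus_diag, Rabs_R0; apply cond_pos.
Qed.

Lemma eq_endpoints (f : R -> R) (r a b : R) :
  (forall eps, 0 < eps -> exists delta : posreal, forall x y, 0 <= x <= r -> 0 <= y <= r ->
    Rabs (y - x) < delta -> Rabs (f y - f x) <= eps) ->
  0 <= a < b -> b <= r ->
  (forall x y, a < x <= y -> y < b -> f x = f y) -> f a = f b.
Proof.
intros Hc Ha Hb Heq.
apply Rminus_diag_uniq, Rabs_eq_0, Rle_antisym; [ | apply Rabs_pos].
apply le_epsilon; intros eps Heps; rewrite Rplus_0_l.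
destruct (Hc (eps / 2)) as [d Hd]; [ lra | ].
set (k := Rmin (d / 2) ((b - a) / 2)).
assert (Hk : 0 < k) by (apply Rmin_case; [ generalize (cond_pos d) | ]; lra).
assert (Hk1 : k <= d / 2) by apply Rmin_l.
assert (Hk2 : k <= (b - a) / 2) by apply Rmin_r.
generalize (cond_pos d); intros Hd0.
replace (f a - f b) with ((f a - f (a + k)) + (f (b - k) - f b))
  by (rewrite (Heq (a + k) (b - k)) by lra; ring).
eapply Rle_trans; [ apply Rabs_triang | ].
replace eps with (eps / 2 + eps / 2) by field.
apply Rplus_le_compat; apply Hd; try lra; apply Rabs_lt_between; lra.
Qed.

(** The means are constant on either side of [rho] and continuous, hence constant
    up to the centre, where the mean is [g 0]. *)
Lemma circle_mean_value_except (g : C -> C) (r rho : R) :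
  0 < r ->
  (forall z, Cmod z <= r -> Ccont g z) ->
  (forall z, 0 < Cmod z < r -> Cmod z <> rho -> Cdiff g z) ->
  circle_mean (fun z => Re (g z)) r = Re (g 0%C).
Proof.
intros Hr Hc Hg.
set (m := circle_mean (fun z => Re (g z))).
assert (Hm := circle_mean_unif_continuous g r Hc). fold m in Hm.
assert (Heq : forall a b, 0 <= a < b -> b <= r -> rho <= a \/ b <= rho -> m a = m b).
{ intros a b Ha Hb Hrho. apply (eq_endpoints m r); try assumption.
  intros x y Hx Hy. apply circle_mean_radius_indep; [ lra | ].
  intros z Hz; apply Hg; lra. }
(* The circle of radius 0 is the centre, so [m 0] is the value there. *)
replace (Re (g 0%C)) with (m 0).
- destruct (Rle_dec rho 0); [ symmetry; apply Heq; lra | ].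
  destruct (Rle_dec r rho); [ symmetry; apply Heq; lra | ].
  rewrite (Heq 0 rho), (Heq rho r); lra.
- unfold m, circle_mean.
  rewrite (RInt_ext (V := R_CompleteNormedModule) _ (fun _ => Re (g 0%C))).
  + rewrite RInt_const. unfold scal; simpl; unfold mult; simpl. field. apply PI_neq0.
  + intros t _. do 2 f_equal. unfold circle_point. now rewrite !Rmult_0_l.
Qed.

Lemma circle_mean_value (g : C -> C) (r : R) :
  0 < r -> (forall z, Cmod z <= r -> Cdiff g z) ->
  circle_mean (fun z => Re (g z)) r = Re (g 0%C).
Proof.
intros Hr Hg; apply (circle_mean_value_except g r 0 Hr).
- intros z Hz; now apply Cdiff_Ccont, Hg.
- intros z Hz _; apply Hg; lra.
Qed.

(** * The Poisson kernel *)

Definition poisson (s : R) (w zeta : C) : R := (s ^ 2 - Cmod w ^ 2) / Cmod (zeta - w)%C ^ 2.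

Lemma Cmod_lt_Cminus_neq_0 (w zeta : C) : Cmod w < Cmod zeta -> (zeta - w)%C <> 0%C.
Proof.
intros H; apply Cminus_eq_contra; intros ->. lra.
Qed.

(** This is why the Poisson kernel is harmonic in [w]. *)
Lemma poisson_Re (w zeta : C) :
  zeta <> w -> poisson (Cmod zeta) w zeta = Re ((zeta + w) / (zeta - w))%C.
Proof.
intros H. assert (H0 := Cminus_eq_contra _ _ H).
apply Cmod_gt_0 in H0. apply (pow_lt _ 2) in H0.
unfold poisson. rewrite !Cmod2_alt in *.
destruct zeta as [x y], w as [u v]; unfold Re, Im in *; simpl in *. field; lra.
Qed.

Lemma continuous_Rdiv {T : UniformSpace} (f g : T -> R) x :
  continuous f x -> continuous g x -> g x <> 0 -> continuous (fun t => f t / g t) x.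
Proof.
intros Hf Hg H0. apply (continuous_mult (K := R_AbsRing)); [ exact Hf | ].
apply (continuous_comp g Rinv); [ exact Hg | ].
apply (ex_derive_continuous (K := R_AbsRing) (V := R_NormedModule)). now auto_derive.
Qed.

Lemma continuous_Cmod_sq {T : UniformSpace} (f : T -> C) x :
  continuous (fun t => Re (f t)) x -> continuous (fun t => Im (f t)) x ->
  continuous (fun t => Cmod (f t) ^ 2) x.
Proof.
intros Hr Hi. assert (E : forall t, Re (f t) * Re (f t) + Im (f t) * Im (f t) = Cmod (f t) ^ 2)
  by (intros t; rewrite Cmod2_alt; ring).
apply (continuous_ext _ _ _ E).
apply (continuous_plus (V := R_NormedModule)); now apply (continuous_mult (K := R_AbsRing)).
Qed.

Lemma continuous_poisson {T : UniformSpace} s (w zeta : T -> C) x :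
  continuous (fun t => Re (w t)) x -> continuous (fun t => Im (w t)) x ->
  continuous (fun t => Re (zeta t)) x -> continuous (fun t => Im (zeta t)) x ->
  zeta x <> w x -> continuous (fun t => poisson s (w t) (zeta t)) x.
Proof.
intros Hw1 Hw2 Hz1 Hz2 Hne. unfold poisson. apply continuous_Rdiv.
- apply (continuous_minus (V := R_NormedModule)); [ apply continuous_const | ].
  now apply continuous_Cmod_sq.
- apply continuous_Cmod_sq; now apply (continuous_minus (V := R_NormedModule)).
- apply pow_nonzero, Rgt_not_eq, Cmod_gt_0. now apply Cminus_eq_contra.
Qed.

Lemma continuous_Re_circle_point (g : C -> C) r t :
  Ccont g (circle_point r t) -> continuous (fun t => Re (g (circle_point r t))) t.
Proof.
intros H; apply (continuity_2d_pt_continuous_2 (fun x y => Re (g (circle_point x y)))).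
now apply continuity_2d_Re_circle_point.
Qed.

Lemma continuous_Im_circle_point (g : C -> C) r t :
  Ccont g (circle_point r t) -> continuous (fun t => Im (g (circle_point r t))) t.
Proof.
intros H; apply (continuity_2d_pt_continuous_2 (fun x y => Im (g (circle_point x y)))).
now apply continuity_2d_Im_circle_point.
Qed.

Lemma circle_mean_ext h k r :
  (forall z, Cmod z = Rabs r -> h z = k z) -> circle_mean h r = circle_mean k r.
Proof.
intros H. unfold circle_mean; f_equal. apply (RInt_ext (V := R_CompleteNormedModule)).
intros t _; apply H, Cmod_circle_point.
Qed.

Section Poisson.
Variables (s : R) (w : C).
Hypothesis (Hw : Cmod w < s).

Let s_pos : 0 < s.
Proof. eapply Rle_lt_trans; [ apply Cmod_ge_0 | exact Hw]. Qed.

Lemma reflected_pole_neq (z : C) : Cmod z <= s -> (RtoC (s ^ 2) - Cconj w * z)%C <> 0%C.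
Proof.
intros Hz. apply Cmod_lt_Cminus_neq_0. rewrite Cmod_mult, Cmod_conj, Cmod_R, Rabs_pos_eq by apply pow2_ge_0.
apply Rle_lt_trans with (Cmod w * s); [ | simpl; nra].
apply Rmult_le_compat_l; [ apply Cmod_ge_0 | exact Hz].
Qed.

(** On the circle the conjugate of [z - w], which is not analytic, agrees up to the
    factor [z] with an analytic function, whose zero s^2 / conj(w) lies outside
    the disk. *)
Lemma reflected_pole (z : C) : Cmod z = s -> (RtoC (s ^ 2) - Cconj w * z)%C = (z * Cconj (z - w))%C.
Proof.
intros Hz. rewrite <- Hz, Cmod2_conj, Cminus_conj. ring.
Qed.

(** On the circle the kernel is also the real part of a function of [z] that is
    analytic on the closed disk and takes the value 1 at 0. *)
Lemma circle_mean_poisson : circle_mean (poisson s w) s = 1.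
Proof.
set (g := fun z => ((RtoC (s ^ 2) + Cconj w * z) / (RtoC (s ^ 2) - Cconj w * z))%C).
rewrite (circle_mean_ext _ (fun z => Re (g z))).
- rewrite circle_mean_value; [ | exact s_pos | ].
  + unfold g. rewrite Cmult_0_r. unfold Cminus; rewrite Copp_0, Cplus_0_r. 
    unfold Cdiv; rewrite Cinv_r; [ reflexivity | ].
    apply Cmod_gt_0. rewrite Cmod_R, Rabs_pos_eq; simpl; nra.
  + intros z Hz. unfold g. apply Cdiff_div; [ | | now apply reflected_pole_neq].
    * apply Cdiff_plus; [ apply Cdiff_const | apply Cdiff_mult; [ apply Cdiff_const | apply Cdiff_id]].
    * apply Cdiff_minus; [ apply Cdiff_const | apply Cdiff_mult; [ apply Cdiff_const | apply Cdiff_id]].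
- intros z Hz. rewrite Rabs_pos_eq in Hz by (apply Rlt_le, s_pos).
  assert (Hzw : (z - w)%C <> 0%C) by (apply Cmod_lt_Cminus_neq_0; lra).
  assert (Hz0 : z <> 0%C) by (apply Cmod_gt_0; lra).
  unfold g. rewrite reflected_pole by exact Hz.
  replace (RtoC (s ^ 2) + Cconj w * z)%C with (z * Cconj (z + w))%C
    by (rewrite <- Hz, Cmod2_conj, Cplus_conj; ring).
  replace (z * Cconj (z + w) / (z * Cconj (z - w)))%C with (Cconj ((z + w) / (z - w)))%C.
  + rewrite re_conj. rewrite <- Hz. apply poisson_Re.
    intros ->; apply Hzw; ring.
  + assert (Hc : Cconj (z - w)%C <> 0%C) by (apply Cmod_gt_0; rewrite Cmod_conj; now apply Cmod_gt_0).
    rewrite Cdiv_conj by exact Hzw. now field.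
Qed.

(** The kernel as a multiple of 1 / (z - w) by a factor that is analytic
    in the disk and vanishes at 0. *)
Lemma poisson_kernel_C (z : C) : Cmod z = s ->
  (RtoC (poisson s w z) = z * (RtoC (s ^ 2 - Cmod w ^ 2) / (RtoC (s ^ 2) - Cconj w * z)) / (z - w))%C.
Proof.
intros Hz.
assert (Hzw : (z - w)%C <> 0%C) by (apply Cmod_lt_Cminus_neq_0; lra).
assert (Hz0 : z <> 0%C) by (apply Cmod_gt_0; lra).
assert (Hc : Cconj (z - w)%C <> 0%C) by (apply Cmod_gt_0; rewrite Cmod_conj; now apply Cmod_gt_0).
rewrite reflected_pole by exact Hz. unfold poisson.
rewrite RtoC_div, Cmod2_conj.
- now field.
- apply pow_nonzero, Rgt_not_eq. now apply Cmod_gt_0.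
Qed.

Variable f : C -> C.
Hypothesis Hf : forall z, Cmod z <= s -> Cdiff f z.

(** The difference quotient, extended by the derivative at [w]: continuity there is
    all that the mean value property with an exceptional circle asks for. *)
Lemma difference_quotient : exists Q : C -> C,
  (forall z, z <> w -> Q z = (f z - f w) / (z - w))%C /\
  (forall z, z <> w -> Cmod z <= s -> Cdiff Q z) /\
  (forall z, Cmod z <= s -> Ccont Q z).
Proof.
destruct (Hf w (Rlt_le _ _ Hw)) as [l Hl]. rewrite is_derive_C_eps in Hl.
set (Q := fun z => if excluded_middle_informative (z = w) then l else ((f z - f w) / (z - w))%C).
assert (HQ : forall z, z <> w -> Q z = ((f z - f w) / (z - w))%C).
{ intros z Hz; unfold Q; now destruct excluded_middle_informative. }
assert (HD : forall z, z <> w -> Cmod z <= s -> Cdiff Q z).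
{ intros z Hz Hzs. apply (Cdiff_ext_loc (fun z => (f z - f w) / (z - w))%C).
  - assert (Hp : 0 < Cmod (w - z)%C).
    { apply Cmod_gt_0, Cminus_eq_contra. now intros ->. }
    exists (mkposreal _ Hp); intros y Hy. symmetry; apply HQ; intros ->.
    apply (Rlt_irrefl (Cmod (w - z)%C)). exact Hy.
  - apply Cdiff_div; [ | | now apply Cminus_eq_contra].
    + apply Cdiff_minus; [ now apply Hf | apply Cdiff_const].
    + apply Cdiff_minus; [ apply Cdiff_id | apply Cdiff_const]. }
exists Q; split; [ exact HQ | split; [ exact HD | ]].
intros z Hz. destruct (excluded_middle_informative (z = w)) as [-> | Hzw];
  [ | now apply Cdiff_Ccont, HD].
apply Ccont_eps; intros eps. destruct (Hl (pos_div_2 eps)) as [d Hd].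
exists d; intros y Hy. unfold Q at 2. destruct excluded_middle_informative as [_ | n]; [ | easy].
destruct (excluded_middle_informative (y = w)) as [-> | Hyw].
- unfold Q. destruct excluded_middle_informative as [_ | n]; [ | easy].
  unfold Cminus; rewrite Cplus_opp_r, Cmod_0. apply cond_pos.
- rewrite HQ by exact Hyw. specialize (Hd y Hy). assert (Hne := Cminus_eq_contra y w Hyw).
  replace ((f y - f w) / (y - w) - l)%C with ((f y - f w - (y - w) * l) / (y - w))%C by (now field).
  rewrite Cmod_div by exact Hne. apply Cmod_gt_0 in Hne.
  apply Rle_lt_trans with (eps / 2); [ | generalize (cond_pos eps); lra].
  apply Rle_div_l; [ exact Hne | exact Hd].
Qed.

Lemma ex_RInt_poisson_mult (h : C -> R) :
  (forall t, continuous (fun t => h (circle_point s t)) t) ->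
  ex_RInt (fun t => poisson s w (circle_point s t) * h (circle_point s t)) 0 (2 * PI).
Proof.
intros Hh. apply (ex_RInt_continuous (V := R_CompleteNormedModule)). intros t _.
apply (continuous_mult (K := R_AbsRing)); [ | apply Hh].
apply continuous_poisson; try apply continuous_const.
- apply (continuous_Re_circle_point (fun z => z)), Cdiff_Ccont, Cdiff_id.
- apply (continuous_Im_circle_point (fun z => z)), Cdiff_Ccont, Cdiff_id.
- intros E. generalize Hw; rewrite <- E, Cmod_circle_point, Rabs_pos_eq; lra.
Qed.

(** Poisson's formula. The integrand is the real part of c Q(z) k(z), with
    Q the difference quotient of [f] at [w] and k an analytic factor with k(0) = 0, so
    the mean value property gives zero. *)
Lemma circle_mean_poisson_minus (c : C) :
  circle_mean (fun z => poisson s w z * Re (c * (f z - f w))%C) s = 0.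
Proof.
destruct difference_quotient as [Q [HQ [HD HC]]].
(* [Q z * k z] is [(f z - f w) * poisson s w z] on the circle. *)
set (k := fun z => (z * (RtoC (s ^ 2 - Cmod w ^ 2) / (RtoC (s ^ 2) - Cconj w * z)))%C).
set (g := fun z => (c * (Q z * k z))%C).
assert (Hk : forall z, Cmod z <= s -> Cdiff k z).
{ intros z Hz. unfold k. apply Cdiff_mult; [ apply Cdiff_id | ].
  apply Cdiff_div; [ apply Cdiff_const | | now apply reflected_pole_neq].
  apply Cdiff_minus; [ apply Cdiff_const | apply Cdiff_mult; [ apply Cdiff_const | apply Cdiff_id]]. }
rewrite (circle_mean_ext _ (fun z => Re (g z))).
- rewrite (circle_mean_value_except g s (Cmod w) s_pos).
  + unfold g, k. rewrite Cmult_0_l, !Cmult_0_r. reflexivity.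
  + intros z Hz. apply Ccont_mult; [ apply Cdiff_Ccont, Cdiff_const | ].
    apply Ccont_mult; [ now apply HC | now apply Cdiff_Ccont, Hk].
  + intros z Hz Hzw. apply Cdiff_mult; [ apply Cdiff_const | ].
    apply Cdiff_mult; [ apply HD; [ intros ->; now apply Hzw | lra] | apply Hk; lra].
- intros z Hz. rewrite Rabs_pos_eq in Hz by (apply Rlt_le, s_pos).
  assert (Hzw : (z - w)%C <> 0%C) by (apply Cmod_lt_Cminus_neq_0; lra).
  rewrite <- re_scal_l, poisson_kernel_C by exact Hz. fold (k z). f_equal. unfold g.
  rewrite HQ; [ now field | ]. intros ->; apply Hzw; ring.
Qed.

Lemma poisson_pos (z : C) : Cmod z = s -> 0 < poisson s w z.
Proof.
intros Hz. apply Rdiv_lt_0_compat.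
- generalize (Cmod_ge_0 w); simpl; nra.
- apply pow_lt, Cmod_gt_0, Cmod_lt_Cminus_neq_0. lra.
Qed.

(** Average the inequality |f(z)|^2 >= |f(w)|^2 + 2 Re(conj(f(w)) (f(z) - f(w)))
    against the Poisson kernel: by Poisson's formula the last term vanishes. *)
Lemma Cmod_sq_le_poisson_mean :
  Cmod (f w) ^ 2 <= circle_mean (fun z => poisson s w z * Cmod (f z) ^ 2) s.
Proof.
assert (Hs : forall t, Cmod (circle_point s t) = s).
{ intros t; rewrite Cmod_circle_point, Rabs_pos_eq; lra. }
assert (Hc : forall t, Ccont f (circle_point s t)).
{ intros t; apply Cdiff_Ccont, Hf; rewrite Hs; lra. }
set (c := (2 * Cconj (f w))%C).
assert (E1 := circle_mean_poisson_minus c).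
assert (E2 := circle_mean_poisson).
unfold circle_mean in *. set (P := fun t => poisson s w (circle_point s t)) in *.
set (h := fun t => Re (c * (f (circle_point s t) - f w))%C).
assert (I1 : ex_RInt (fun t => P t * h t) 0 (2 * PI)).
{ apply (ex_RInt_poisson_mult (fun z => Re (c * (f z - f w))%C)). intros t.
  apply (continuous_Re_circle_point (fun z => c * (f z - f w))%C), Ccont_mult.
  - apply Cdiff_Ccont, Cdiff_const.
  - apply Cdiff_Ccont, Cdiff_minus; [ apply Hf; rewrite Hs; lra | apply Cdiff_const]. }
assert (I2 : ex_RInt (fun t => P t * 1) 0 (2 * PI)).
{ apply (ex_RInt_poisson_mult (fun _ => 1)). intros t; apply continuous_const. }
assert (I3 : ex_RInt (fun t => P t * Cmod (f (circle_point s t)) ^ 2) 0 (2 * PI)).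
{ apply (ex_RInt_poisson_mult (fun z => Cmod (f z) ^ 2)). intros t.
  apply continuous_Cmod_sq; [ now apply continuous_Re_circle_point | now apply continuous_Im_circle_point]. }
assert (HPI := two_PI_pos).
assert (I4 : ex_RInt (fun t => Cmod (f w) ^ 2 * (P t * 1)) 0 (2 * PI))
  by now apply (ex_RInt_scal (V := R_NormedModule)).
assert (E : / (2 * PI) * RInt (fun t => P t * h t + Cmod (f w) ^ 2 * (P t * 1)) 0 (2 * PI)
  = Cmod (f w) ^ 2).
{ assert (S1 := RInt_plus (V := R_CompleteNormedModule) _ _ _ _ I1 I4).
  assert (S2 := RInt_scal (V := R_CompleteNormedModule) _ _ _ (Cmod (f w) ^ 2) I2).
  unfold plus, scal in S1, S2; simpl in S1, S2; unfold mult in S2; simpl in S2.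
  simpl. rewrite S1, S2.
  rewrite (RInt_ext (fun t => P t * 1) P) by (intros; apply Rmult_1_r).
  change (/ (2 * PI) * RInt (fun t => P t * h t) 0 (2 * PI) = 0) in E1.
  rewrite Rmult_plus_distr_l, E1, Rplus_0_l, <- Rmult_assoc, (Rmult_comm (/ (2 * PI))), Rmult_assoc.
  change (/ (2 * PI) * RInt P 0 (2 * PI) = 1) in E2. rewrite E2. ring. }
rewrite <- E at 1. apply Rmult_le_compat_l; [ apply Rlt_le, Rinv_0_lt_compat, HPI | ].
apply RInt_le; [ lra | | exact I3 | ].
- exact (ex_RInt_plus (V := R_NormedModule) _ _ _ _ I1 I4).
- intros t _.
  replace (P t * h t + Cmod (f w) ^ 2 * (P t * 1))
    with (P t * (h t + Cmod (f w) ^ 2)) by ring.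
  apply Rmult_le_compat_l; [ apply Rlt_le, poisson_pos, Hs | ].
  change (h t + Cmod (f w) ^ 2 <= Cmod (f (circle_point s t)) ^ 2).
  unfold h, c. rewrite !Cmod2_alt.
  destruct (f w) as [a b], (f (circle_point s t)) as [x y]; unfold Re, Im; simpl.
  generalize (pow2_ge_0 (x - a)) (pow2_ge_0 (y - b)); simpl; lra.
Qed.
End Poisson.

(** * Subordination on circles *)

Lemma continuity_2d_pt_swap k x y :
  continuity_2d_pt k x y -> continuity_2d_pt (fun u v => k v u) y x.
Proof.
intros H eps; destruct (H eps) as [d Hd]; exists d; intros u v Hu Hv; now apply Hd.
Qed.

Lemma ex_RInt_continuity_2d k x a b :
  (forall y, continuity_2d_pt k x y) -> ex_RInt (k x) a b.
Proof.
intros H; apply (ex_RInt_continuous (V := R_CompleteNormedModule)); intros t _.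
now apply continuity_2d_pt_continuous_2.
Qed.

Lemma continuous_RInt_param_le k a b x :
  a <= b -> (forall x y, continuity_2d_pt k x y) -> continuous (fun x => RInt (k x) a b) x.
Proof.
intros Hab Hk P [eps HP].
assert (He : 0 < eps / (b - a + 1)) by (apply Rdiv_lt_0_compat; [ apply cond_pos | lra]).
destruct (uniform_continuity_2d k (x - 1) (x + 1) a b (fun x y _ _ => Hk x y) (mkposreal _ He)) as [d Hd].
assert (Hd1 : 0 < Rmin d 1) by (apply Rmin_pos; [ apply cond_pos | lra]).
exists (mkposreal _ Hd1); simpl; intros y Hy. apply HP.
change (Rabs (y - x) < Rmin d 1) in Hy.
change (Rabs (minus (RInt (k y) a b) (RInt (k x) a b)) < eps).
rewrite <- RInt_minus by (apply ex_RInt_continuity_2d, Hk).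
apply Rle_lt_trans with ((b - a) * (eps / (b - a + 1))).
- apply abs_RInt_le_const; [ exact Hab | | ].
  + apply (ex_RInt_minus (V := R_NormedModule)); apply ex_RInt_continuity_2d, Hk.
  + intros t Ht. generalize (Rmin_l d 1) (Rmin_r d 1); intros.
    assert (Hy1 : Rabs (y - x) < 1) by lra. apply Rabs_def2 in Hy1.
    apply Rlt_le, Hd; try lra. rewrite Rminus_diag, Rabs_R0; apply cond_pos.
- replace ((b - a) * (eps / (b - a + 1))) with (eps * ((b - a) / (b - a + 1))) by (field; lra).
  rewrite <- (Rmult_1_r eps) at 2. apply Rmult_lt_compat_l; [ apply cond_pos | ].
  apply Rlt_div_l; lra.
Qed.

Lemma continuous_RInt_param k a b x :
  (forall x y, continuity_2d_pt k x y) -> continuous (fun x => RInt (k x) a b) x.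
Proof.
intros Hk. destruct (Rle_dec a b) as [H | H]; [ now apply continuous_RInt_param_le | ].
apply (continuous_ext (fun x => opp (RInt (k x) b a))).
- intros t. apply opp_RInt_swap, ex_RInt_continuity_2d, Hk.
- apply (continuous_opp (V := R_NormedModule)), continuous_RInt_param_le; [ lra | exact Hk].
Qed.

(** Both sides vanish for [a = b] and have the same derivative in [b]. *)
Lemma RInt_swap_order k a b c d :
  (forall x y, continuity_2d_pt k x y) ->
  RInt (fun x => RInt (k x) c d) a b = RInt (fun y => RInt (fun x => k x y) a b) c d.
Proof.
intros Hk.
assert (Hk' : forall x y, continuity_2d_pt (fun u v => k v u) x y)
  by (intros; apply continuity_2d_pt_swap, Hk).
assert (D1 : forall x, is_derive (fun x => RInt (fun t => RInt (k t) c d) a x) x (RInt (k x) c d)).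
{ intros x. apply (is_derive_RInt (V := R_NormedModule) (fun t => RInt (k t) c d)
    (fun x => RInt (fun t => RInt (k t) c d) a x) a).
  - apply filter_forall; intros y. apply (RInt_correct (V := R_CompleteNormedModule)), (ex_RInt_continuous (V := R_CompleteNormedModule)).
    intros; now apply continuous_RInt_param.
  - now apply continuous_RInt_param. }
assert (D0 : forall x y, is_derive (fun u => RInt (fun t => k t y) a u) x (k x y)).
{ intros x y. apply (is_derive_RInt (V := R_NormedModule) (fun t => k t y)
    (fun u => RInt (fun t => k t y) a u) a).
  - apply filter_forall; intros z. apply (RInt_correct (V := R_CompleteNormedModule)).
    apply (ex_RInt_continuity_2d (fun u v => k v u) y a z), Hk'.
  - apply continuity_2d_pt_continuous_1, Hk. }
assert (D2 : forall x, is_derive (fun x => RInt (fun y => RInt (fun t => k t y) a x) c d) x (RInt (k x) c d)).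
{ intros x.
  rewrite (RInt_ext (k x) (fun y => Derive (fun u => RInt (fun t => k t y) a u) x)).
  - apply (is_derive_RInt_param (fun x y => RInt (fun t => k t y) a x)).
    + apply filter_forall; intros u t _; eexists; apply D0.
    + intros t _. apply (continuity_2d_pt_ext k); [ | apply Hk].
      intros u v; symmetry; apply is_derive_unique, D0.
    + apply filter_forall; intros u. apply (ex_RInt_continuous (V := R_CompleteNormedModule)).
      intros z _. now apply (continuous_RInt_param (fun u v => k v u)).
  - intros t _; symmetry; apply is_derive_unique, D0. }
set (F := fun x => RInt (fun t => RInt (k t) c d) a x - RInt (fun y => RInt (fun t => k t y) a x) c d).
assert (HF : forall x, is_derive F x 0).
{ intros x. replace 0 with (RInt (k x) c d - RInt (k x) c d) by ring.
  apply (is_derive_minus (V := R_NormedModule)); [ apply D1 | apply D2]. }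
assert (E : F a = F b).
{ destruct (Rtotal_order a b) as [H | [-> | H]]; [ | reflexivity | symmetry];
    apply (eq_is_derive (V := R_NormedModule)); try assumption; intros; apply HF. }
apply Rminus_diag_uniq. change (F b = 0). rewrite <- E. unfold F.
rewrite RInt_point, (RInt_ext _ (fun _ => 0)).
- rewrite RInt_const. unfold zero, scal; simpl; unfold mult; simpl. ring.
- intros; now rewrite RInt_point.
Qed.

Lemma poisson_le s (w z : C) : Cmod w < s -> Cmod z = s ->
  poisson s w z <= (s + Cmod w) / (s - Cmod w).
Proof.
intros Hw Hz.
assert (H : s - Cmod w <= Cmod (z - w)%C).
{ assert (Cmod z <= Cmod (z - w)%C + Cmod w); [ | lra].
  replace z with ((z - w) + w)%C at 1 by ring. apply Cmod_triangle. }
generalize (Cmod_ge_0 w); intros H0.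
unfold poisson. replace ((s + Cmod w) / (s - Cmod w)) with ((s ^ 2 - Cmod w ^ 2) / (s - Cmod w) ^ 2) by (field; lra).
apply Rmult_le_compat_l; [ simpl; nra | ].
apply Rinv_le_contravar; [ apply pow_lt; lra | apply pow_incr; lra].
Qed.

(** The kernel composed with [b] is the real part of the analytic function
    (zeta + b) / (zeta - b). *)
Lemma circle_mean_poisson_comp (b : C -> C) (r s : R) (zeta : C) :
  0 < r -> (forall z, Cmod z <= r -> Cdiff b z) -> (forall z, Cmod z <= r -> Cmod (b z) < s) ->
  Cmod zeta = s ->
  circle_mean (fun z => poisson s (b z) zeta) r = poisson s (b 0%C) zeta.
Proof.
intros Hr Hb Hbs Hz.
assert (Hne : forall z, Cmod z <= r -> zeta <> b z).
{ intros z Hzr E. specialize (Hbs z Hzr). rewrite <- E in Hbs; lra. }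
assert (Hne' : forall z, Cmod z <= r -> (zeta - b z)%C <> 0%C).
{ intros z Hzr. apply Cmod_lt_Cminus_neq_0. rewrite Hz; now apply Hbs. }
rewrite <- Hz.
rewrite (circle_mean_ext _ (fun z => Re ((zeta + b z) / (zeta - b z))%C)).
- rewrite poisson_Re by (apply Hne; rewrite Cmod_0; lra).
  apply (circle_mean_value (fun z => (zeta + b z) / (zeta - b z))%C r Hr).
  intros z Hzr. apply Cdiff_div; [ | | now apply Hne'].
  + apply Cdiff_plus; [ apply Cdiff_const | now apply Hb].
  + apply Cdiff_minus; [ apply Cdiff_const | now apply Hb].
- intros z Hzr. apply poisson_Re, Hne. rewrite Hzr, Rabs_pos_eq; lra.
Qed.

(** Bound |f(b(z))|^2 by the Poisson mean, exchange the order of integration, and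
    evaluate the mean over [z] of the kernel. *)
Lemma circle_mean_sq_comp_le (b f : C -> C) (r s : R) :
  0 < r -> (forall z, Cmod z <= r -> Cdiff b z) -> (forall z, Cmod z <= r -> Cmod (b z) < s) ->
  (forall z, Cmod z <= s -> Cdiff f z) ->
  circle_mean_sq (fun z => f (b z)) r <= (s + Cmod (b 0%C)) / (s - Cmod (b 0%C)) * circle_mean_sq f s.
Proof.
intros Hr Hb Hbs Hf.
assert (Hb0 : Cmod (b 0%C) < s) by (apply Hbs; rewrite Cmod_0; lra).
assert (Hs : 0 < s) by (eapply Rle_lt_trans; [ apply Cmod_ge_0 | exact Hb0]).
set (kappa := (s + Cmod (b 0%C)) / (s - Cmod (b 0%C))).
assert (Hrt : forall t, Cmod (circle_point r t) = r) by (intros; rewrite Cmod_circle_point, Rabs_pos_eq; lra).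
assert (Hst : forall t, Cmod (circle_point s t) = s) by (intros; rewrite Cmod_circle_point, Rabs_pos_eq; lra).
assert (Cb : forall t, Ccont b (circle_point r t)) by (intros t; apply Cdiff_Ccont, Hb; rewrite Hrt; lra).
assert (Cf : forall t, Ccont f (circle_point s t)) by (intros t; apply Cdiff_Ccont, Hf; rewrite Hst; lra).
assert (Cfb : forall t, Ccont (fun z => f (b z)) (circle_point r t)).
{ intros t; apply Cdiff_Ccont, (Cdiff_comp f b).
  - apply Hf, Rlt_le, Hbs; rewrite Hrt; lra.
  - apply Hb; rewrite Hrt; lra. }
assert (Ci : forall t, Ccont (fun z => z) (circle_point s t)) by (intros t; apply Cdiff_Ccont, Cdiff_id).
set (k := fun phi theta => poisson s (b (circle_point r phi)) (circle_point s theta)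
  * Cmod (f (circle_point s theta)) ^ 2).
assert (Cf2 : forall t, continuous (fun t => Cmod (f (circle_point s t)) ^ 2) t).
{ intros t; apply continuous_Cmod_sq; [ now apply continuous_Re_circle_point | now apply continuous_Im_circle_point]. }
assert (Hk : forall x y, continuity_2d_pt k x y).
{ intros x y. apply continuity_2d_pt_filterlim.
  apply (continuous_mult (K := R_AbsRing) (U := prod_UniformSpace R_UniformSpace R_UniformSpace)
    (fun p => poisson s (b (circle_point r (fst p))) (circle_point s (snd p)))
    (fun p => Cmod (f (circle_point s (snd p))) ^ 2) (x, y)).
  - apply continuous_poisson.
    + apply (continuous_comp fst (fun t => Re (b (circle_point r t)))); [ apply continuous_fst | now apply continuous_Re_circle_point].
    + apply (continuous_comp fst (fun t => Im (b (circle_point r t)))); [ apply continuous_fst | now apply continuous_Im_circle_point].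
    + apply (continuous_comp snd (fun t => Re (circle_point s t))); [ apply continuous_snd | now apply (continuous_Re_circle_point (fun z => z))].
    + apply (continuous_comp snd (fun t => Im (circle_point s t))); [ apply continuous_snd | now apply (continuous_Im_circle_point (fun z => z))].
    + simpl. intros E. apply (Rlt_irrefl s). rewrite <- (Hst y) at 1. rewrite E.
      apply Hbs. rewrite Hrt; lra.
  - apply (continuous_comp snd (fun t => Cmod (f (circle_point s t)) ^ 2)); [ apply continuous_snd | apply Cf2]. }
assert (HPI := two_PI_pos). assert (HPI' := Rinv_0_lt_compat _ HPI).
assert (Ck : forall x, continuous (fun phi => RInt (k phi) 0 (2 * PI)) x) by (intros; now apply continuous_RInt_param).
assert (Ck' : forall y, continuous (fun theta => RInt (fun phi => k phi theta) 0 (2 * PI)) y).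
{ intros; apply (continuous_RInt_param (fun u v => k v u)). intros; now apply continuity_2d_pt_swap. }
assert (Step1 : RInt (fun phi => Cmod (f (b (circle_point r phi))) ^ 2) 0 (2 * PI)
  <= / (2 * PI) * RInt (fun phi => RInt (k phi) 0 (2 * PI)) 0 (2 * PI)).
{ change (/ (2 * PI) * RInt (fun phi => RInt (k phi) 0 (2 * PI)) 0 (2 * PI))
    with (scal (/ (2 * PI)) (RInt (fun phi => RInt (k phi) 0 (2 * PI)) 0 (2 * PI))).
  rewrite <- (RInt_scal (V := R_CompleteNormedModule)).
  - apply RInt_le; [ lra | | | ].
    + apply (ex_RInt_continuous (V := R_CompleteNormedModule)); intros t _.
      apply continuous_Cmod_sq.
      * now apply (continuous_Re_circle_point (fun z => f (b z))).
      * now apply (continuous_Im_circle_point (fun z => f (b z))).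
    + apply (ex_RInt_scal (V := R_NormedModule)), (ex_RInt_continuous (V := R_CompleteNormedModule)).
      intros; apply Ck.
    + intros t _. refine (Cmod_sq_le_poisson_mean s _ _ f Hf). apply Hbs; rewrite Hrt; lra.
  - apply (ex_RInt_continuous (V := R_CompleteNormedModule)). intros; apply Ck. }
assert (Step2 : forall theta, RInt (fun phi => k phi theta) 0 (2 * PI)
  <= 2 * PI * kappa * Cmod (f (circle_point s theta)) ^ 2).
{ intros theta. set (q := Cmod (f (circle_point s theta)) ^ 2).
  rewrite (RInt_ext _ (fun phi => scal q (poisson s (b (circle_point r phi)) (circle_point s theta))))
    by (intros; apply Rmult_comm).
  assert (E := circle_mean_poisson_comp b r s (circle_point s theta) Hr Hb Hbs (Hst theta)).
  unfold circle_mean in E.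
  rewrite (RInt_scal (V := R_CompleteNormedModule)).
  - unfold scal; simpl; unfold mult; simpl.
    rewrite (Rmult_comm (_ * _) q). apply Rmult_le_compat_l; [ apply pow2_ge_0 | ].
    rewrite (Rmult_comm (2 * PI) kappa). apply Rle_div_l; [ lra | ].
    unfold Rdiv; rewrite Rmult_comm, E. now apply poisson_le.
  - apply (ex_RInt_continuous (V := R_CompleteNormedModule)); intros t _.
    apply continuous_poisson; try apply continuous_const.
    + now apply continuous_Re_circle_point.
    + now apply continuous_Im_circle_point.
    + intros E'. apply (Rlt_irrefl s). rewrite <- (Hst theta) at 1. rewrite E'.
      apply Hbs. rewrite Hrt; lra. }
rewrite (RInt_swap_order k 0 (2 * PI) 0 (2 * PI) Hk) in Step1.
assert (Step3 : RInt (fun y => RInt (fun x => k x y) 0 (2 * PI)) 0 (2 * PI)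
  <= 2 * PI * kappa * RInt (fun theta => Cmod (f (circle_point s theta)) ^ 2) 0 (2 * PI)).
{ assert (If : ex_RInt (fun theta => Cmod (f (circle_point s theta)) ^ 2) 0 (2 * PI)).
  { apply (ex_RInt_continuous (V := R_CompleteNormedModule)); intros; apply Cf2. }
  change (2 * PI * kappa * RInt (fun theta => Cmod (f (circle_point s theta)) ^ 2) 0 (2 * PI))
    with (scal (2 * PI * kappa) (RInt (fun theta => Cmod (f (circle_point s theta)) ^ 2) 0 (2 * PI))).
  rewrite <- (RInt_scal (V := R_CompleteNormedModule)) by exact If.
  apply RInt_le; [ lra | | | ].
  - apply (ex_RInt_continuous (V := R_CompleteNormedModule)). intros; apply Ck'.
  - now apply (ex_RInt_scal (V := R_NormedModule)).
  - intros t _; apply Step2. }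
unfold circle_mean_sq.
apply Rle_trans with (/ (2 * PI) * (/ (2 * PI) * (2 * PI * kappa * RInt (fun theta => Cmod (f (circle_point s theta)) ^ 2) 0 (2 * PI)))).
- apply Rmult_le_compat_l; [ lra | ]. eapply Rle_trans; [ exact Step1 | ].
  apply Rmult_le_compat_l; [ lra | exact Step3].
- right. field. apply PI_neq0.
Qed.

(** * Passage to the Hardy space *)

Lemma Cmod_minus_lt (x y u v d : R) :
  Rabs (x - u) < d -> Rabs (y - v) < d -> Cmod ((x, y) - (u, v))%C < 2 * d.
Proof.
intros Hx Hy. eapply Rle_lt_trans; [ apply Cmod_2Rmax | ].
apply Rle_lt_trans with (2 * Rmax (Rabs (x - u)) (Rabs (y - v))).
- apply Rmult_le_compat_r; [ eapply Rle_trans; [ apply Rabs_pos | apply Rmax_l] | ].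
  replace 2 with (sqrt (Rsqr 2)) at 2 by (apply sqrt_Rsqr; lra). apply sqrt_le_1_alt. unfold Rsqr; lra.
- apply Rmult_lt_compat_l; [ lra | now apply Rmax_lub_lt].
Qed.

Lemma Cmod_le_plus_minus (z w : C) : Cmod z <= Cmod w + Cmod (z - w)%C.
Proof. replace z with (w + (z - w))%C at 1 by ring. apply Cmod_triangle. Qed.

(** Compactness of the closed disk of radius [r]. The covering is taken of a
    square containing it, with a gauge at the points outside the disk that is too
    small to reach it. *)
Lemma self_map_bounded_away (b : C -> C) (r : R) :
  (forall z, disk z -> Ccont b z) -> (forall z, disk z -> disk (b z)) -> r < 1 ->
  exists s, s < 1 /\ forall z, Cmod z <= r -> Cmod (b z) < s.
Proof.
intros Hc Hb Hr.
assert (Hgauge : forall u v, exists delta : posreal, forall x y,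
  Rabs (x - u) < delta -> Rabs (y - v) < delta -> Cmod (x, y) <= r -> Cmod (b (x, y)) < 1 - delta).
{ intros u v. destruct (Rle_dec (Cmod (u, v)) r) as [Huv | Huv].
  - assert (Hd : disk (u, v)) by (unfold disk; lra).
    assert (H1 := Hb _ Hd). unfold disk in H1.
    assert (He : 0 < (1 - Cmod (b (u, v))) / 2) by lra.
    destruct (proj1 (Ccont_eps b (u, v)) (Hc _ Hd) (mkposreal _ He)) as [d Hd'].
    assert (Hp : 0 < Rmin (d / 2) ((1 - Cmod (b (u, v))) / 2))
      by (apply Rmin_pos; [ generalize (cond_pos d) | ]; lra).
    exists (mkposreal _ Hp); simpl; intros x y Hx Hy _.
    generalize (Rmin_l (d / 2) ((1 - Cmod (b (u, v))) / 2)) (Rmin_r (d / 2) ((1 - Cmod (b (u, v))) / 2)).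
    set (m := Rmin _ _) in *; intros Hm1 Hm2.
    assert (H2 := Cmod_minus_lt x y u v m Hx Hy).
    assert (H3 : Cmod ((x, y) - (u, v))%C < d) by lra.
    specialize (Hd' _ H3). simpl in Hd'.
    generalize (Cmod_le_plus_minus (b (x, y)) (b (u, v))); lra.
  - assert (Hp : 0 < (Cmod (u, v) - r) / 2) by lra.
    (* Points of the disk are at distance at least [Cmod (u, v) - r] from [(u, v)]. *)
    exists (mkposreal _ Hp); simpl; intros x y Hx Hy Hxy. exfalso.
    assert (H2 := Cmod_minus_lt x y u v _ Hx Hy).
    assert (H3 := Cmod_le_plus_minus (u, v) (x, y)).
    replace ((u, v) - (x, y))%C with (- ((x, y) - (u, v)))%C in H3 by ring.
    rewrite Cmod_opp in H3. lra. }
set (delta := fun u v => proj1_sig (constructive_indefinite_description _ (Hgauge u v))).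
assert (Hdelta : forall u v x y, Rabs (x - u) < delta u v -> Rabs (y - v) < delta u v ->
  Cmod (x, y) <= r -> Cmod (b (x, y)) < 1 - delta u v).
{ intros u v; unfold delta. now destruct constructive_indefinite_description. }
destruct (compactness_value_2d (- r) r (- r) r delta) as [d Hd].
exists (1 - d); split; [ generalize (cond_pos d); lra | ].
intros [x y] Hz. apply Rnot_le_lt; intros Hn.
assert (Hx := re_le_Cmod (x, y)). assert (Hy := im_le_Cmod (x, y)). simpl in Hx, Hy.
apply (Hd x y); try (apply Rabs_le_between; lra).
intros [u [v [_ [_ [Hu [Hv Hduv]]]]]].
specialize (Hdelta u v x y Hu Hv Hz). lra.
Qed.

(** This performs the limit [s -> 1], after the denominator [s - |b 0|] has been
    cleared. *)
Lemma affine_le_at_endpoint (s0 p q p' q' : R) :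
  s0 < 1 -> (forall s, s0 < s < 1 -> p * s + q <= p' * s + q') -> p + q <= p' + q'.
Proof.
intros Hs0 H. apply le_epsilon; intros eps Heps.
set (k := Rabs (p - p') + 1).
assert (Hk : 0 < k) by (unfold k; generalize (Rabs_pos (p - p')); lra).
set (t := Rmin ((1 - s0) / 2) (eps / k)).
assert (Ht : 0 < t) by (apply Rmin_pos; [ lra | now apply Rdiv_lt_0_compat]).
assert (Ht1 : t <= (1 - s0) / 2) by apply Rmin_l.
assert (Ht2 : t * k <= eps) by (apply Rle_div_r; [ exact Hk | apply Rmin_r]).
specialize (H (1 - t)).
assert ((p - p') * t <= t * k).
{ rewrite Rmult_comm. apply Rmult_le_compat_l; [ lra | ]. unfold k; generalize (Rle_abs (p - p')); lra. }
assert (p * (1 - t) + q <= p' * (1 - t) + q') by (apply H; lra). lra.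
Qed.

Lemma circle_mean_sq_le_H2_norm_sq (f : C -> C) (r : R) :
  is_finite (H2_norm_sq f) -> 0 < r < 1 -> circle_mean_sq f r <= real (H2_norm_sq f).
Proof.
intros Hf Hr.
assert (H : Rbar_le (circle_mean_sq f r) (H2_norm_sq f)).
{ unfold H2_norm_sq. apply (proj1 (Lub_Rbar_correct _)). now exists r. }
now rewrite <- Hf in H.
Qed.

Lemma H2_norm_sq_le (f : C -> C) (M : R) :
  (forall r, 0 < r < 1 -> circle_mean_sq f r <= M) ->
  is_finite (H2_norm_sq f) /\ real (H2_norm_sq f) <= M.
Proof.
intros H.
assert (H1 : Rbar_le (H2_norm_sq f) M).
{ apply (proj2 (Lub_Rbar_correct _)). intros x [r [Hr ->]]. now apply H. }
assert (H2 : Rbar_le (circle_mean_sq f (/ 2)) (H2_norm_sq f)).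
{ apply (proj1 (Lub_Rbar_correct _)). exists (/ 2); split; [ lra | easy]. }
destruct (H2_norm_sq f); simpl in *; try easy.
Qed.

Lemma circle_mean_sq_composition_le (b f : C -> C) (r : R) :
  analytic_on_disk b -> (forall z, disk z -> disk (b z)) -> H2 f -> 0 < r < 1 ->
  circle_mean_sq (composition_operator b f) r
    <= (1 + Cmod (b 0%C)) / (1 - Cmod (b 0%C)) * real (H2_norm_sq f).
Proof.
intros Hb Hbd [Hf Hfin] Hr.
set (beta := Cmod (b 0%C)). set (L := real (H2_norm_sq f)).
set (M := circle_mean_sq (composition_operator b f) r).
assert (Db : forall z, disk z -> Cdiff b z) by (intros z Hz; now apply ex_derive_Cdiff, Hb).
destruct (self_map_bounded_away b r) as [s0 [Hs0 Hbs]]; [ | exact Hbd | lra | ].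
{ intros z Hz; now apply Cdiff_Ccont, Db. }
assert (Hbeta : beta < s0) by (apply Hbs; rewrite Cmod_0; lra).
assert (Hbeta0 : 0 <= beta) by apply Cmod_ge_0.
assert (Key : forall s, s0 < s < 1 -> M * s + - (M * beta) <= L * s + L * beta).
{ intros s Hs.
  assert (H : M <= (s + beta) / (s - beta) * circle_mean_sq f s).
  { apply (circle_mean_sq_comp_le b f r s).
    - lra.
    - intros z Hz; apply Db; unfold disk; lra.
    - intros z Hz; specialize (Hbs z Hz); lra.
    - intros z Hz; apply ex_derive_Cdiff, Hf; unfold disk; lra. }
  assert (H' : circle_mean_sq f s <= L) by (apply circle_mean_sq_le_H2_norm_sq; [ exact Hfin | lra]).
  replace (M * s + - (M * beta)) with (M * (s - beta)) by ring.
  replace (L * s + L * beta) with ((s + beta) / (s - beta) * L * (s - beta)) by (field; lra).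
  apply Rmult_le_compat_r; [ lra | ]. eapply Rle_trans; [ exact H | ].
  apply Rmult_le_compat_l; [ apply Rdiv_le_0_compat; lra | exact H']. }
apply (affine_le_at_endpoint s0) in Key; [ | exact Hs0].
replace ((1 + beta) / (1 - beta) * L) with ((L + L * beta) / (1 - beta)) by (field; lra).
apply (Rle_div_r M); lra.
Qed.

Lemma H2_norm_composition_le (b f : C -> C) :
  analytic_on_disk b -> (forall z, disk z -> disk (b z)) -> H2 f ->
  H2 (composition_operator b f) /\
  H2_norm (composition_operator b f)
    <= sqrt ((1 + Cmod (b 0%C)) / (1 - Cmod (b 0%C))) * H2_norm f.
Proof.
intros Hb Hbd Hf.
destruct (H2_norm_sq_le (composition_operator b f) _
  (fun r => circle_mean_sq_composition_le b f r Hb Hbd Hf)) as [Hfin Hle].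
split; [ split; [ | exact Hfin] | ].
- intros z Hz. apply ex_derive_Cdiff, (Cdiff_comp f b); apply ex_derive_Cdiff.
  + now apply (proj1 Hf), Hbd.
  + now apply Hb.
- assert (H0 : Cmod (b 0%C) < 1) by (apply Hbd; unfold disk; rewrite Cmod_0; lra).
  unfold H2_norm. rewrite <- sqrt_mult_alt; [ now apply sqrt_le_1_alt | ].
  apply Rdiv_le_0_compat; [ generalize (Cmod_ge_0 (b 0%C)) | ]; lra.
Qed.

Theorem corollary0p2 (b : C -> C)
  (b_analytic : analytic_on_disk b)
  (b_disk : forall z : C, disk z -> disk (b z)) :
  H2_bounded_operator (composition_operator b) /\
  Rbar_le (H2_opnorm (composition_operator b))
    (Finite (sqrt ((1 + Cmod (b (RtoC 0))) / (1 - Cmod (b (RtoC 0))))%R)).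
Proof.
assert (H := fun f Hf => H2_norm_composition_le b f b_analytic b_disk Hf).
split; [ split | ].
- intros f Hf; now apply H.
- intros f g _ _ Hfg z Hz. now apply Hfg, b_disk.
- intros f g _ _ z _; reflexivity.
- intros c f _ z _; reflexivity.
- eexists; intros f Hf; now apply H.
- apply (proj2 (Lub_Rbar_correct _)). intros x [f [Hf [H1 ->]]].
  eapply Rle_trans; [ now apply H | ].
  rewrite <- Rmult_1_r. apply Rmult_le_compat_l; [ apply sqrt_pos | exact H1].
Qed.
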